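(* Let $0<|q|<1$, let $a>0$ be real and let $u\in\mathbb{C}\setminus\{0\}$. Then \[ \sum_{i,j\geq0}\frac{(-1)^{i+j}u^{i-j}q^{(i^{2}-i+j^{2}-j+4a(i-j)^{2})/2}}{(q;q)_{i}(q;q)_{j}} =\frac{(u^{-1}q^{2a},uq^{2a+1},q^{4a+1};q^{4a+1})_{\infty}+ (uq^{2a},u^{-1}q^{2a+1},q^{4a+1};q^{4a+1})_{\infty}}{(q;q)_{\infty}}. \]
   Context: Real powers of $q$ are defined by $q^{x}=e^{x\log q}$ for a fixed choice of $\log q$. For $b\in\mathbb{C}$ and $|p|<1$: $(b;p)_0=1$, $(b;p)_n=\prod_{k=0}^{n-1}(1-bp^k)$, $(b;p)_\infty=\prod_{k\ge0}(1-bp^k)$, and $(b_1,\dots,b_m;p)_\infty=\prod_{r=1}^m(b_r;p)_\infty$. *)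

(* Defs.v *)
From mathcomp Require Import all_boot all_order all_algebra.
From mathcomp Require Import all_classical all_reals all_analysis.
From mathcomp Require Import complex.
From mathcomp.analysis.showcase Require Export summability.
Set Implicit Arguments.
Unset Strict Implicit.
Unset Printing Implicit Defensive.
Import Order.TTheory GRing.Theory Num.Theory.
Import numFieldNormedType.Exports.
Local Open Scope classical_set_scope.
Local Open Scope ring_scope.
Local Open Scope complex_scope.

Definition cexp (R : realType) (z : R[i]) : R[i] :=
  (expR (complex.Re z))%:C * (cos (complex.Im z) +i* sin (complex.Im z)).

(* [rpow logq x] is q^x for real x, where [logq] is the chosen value of log q. *)
Definition rpow (R : realType) (logq : R[i]) (x : R) : R[i] :=
  cexp (x%:C * logq).

Definition qpoch (R : realType) (b p : R[i]) (n : nat) : R[i] :=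
  \prod_(k < n) (1 - b * p ^+ k).

(* [limn] is total, with no convergence proof; the limit exists when `|p| < 1. *)
Definition qpoch_inf (R : realType) (b p : R[i]) : R[i] :=
  limn (fun n => qpoch b p n : R[i]^o).

Definition qpochs_inf (R : realType) (bs : seq R[i]) (p : R[i]) : R[i] :=
  \prod_(b <- bs) qpoch_inf b p.

(* Main.v *)
(* Put n = i - j. The finite q-binomial theorem for (X;q)_m and for the mirrored product
   (q^(1-m)X;q)_m shows that, once 1/(q;q)_i and 1/(q;q)_j are replaced by the q-binomials
   [m,i] and [m,j], the double sum over i, j <= m equals
     sum_n (-u)^n q^(2an^2) (q^(n(n+1)/2) [2m-1, m+n] + q^(n(n-1)/2) [2m-1, m+n-1]).
   With p = q^(4a+1) the two summands are the theta terms (-z)^n p^(n(n-1)/2) for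
   z = u q^(2a+1) and z = u q^(2a), which also occur in the finite Jacobi triple product
     (z;p)_m (p/z;p)_m = sum_n (-z)^n p^(n(n-1)/2) [2m, m+n]_p.
   As m grows, the coefficients tend to 1/(q;q)_oo and 1/(p;p)_oo respectively, and dominated
   convergence of both sums gives the theorem. *)
Require Import Defs.
From mathcomp Require Import all_boot all_order all_algebra.
From mathcomp Require Import all_classical all_reals all_analysis.
From mathcomp Require Import complex finmap ring lra zify.
Import Order.TTheory GRing.Theory Num.Theory.
Import numFieldNormedType.Exports.
Local Open Scope classical_set_scope.
Local Open Scope ring_scope.
Local Open Scope complex_scope.

Set Implicit Arguments.
Unset Strict Implicit.

Local Notation cabs := ComplexField.Normc.normc.

(** * Complex convergence measured by the real-valued modulus *)

Section ComplexLimits.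
Context {R : realType}.
Implicit Types (x y z : R[i]).

Lemma cabsE z : `|z| = (cabs z)%:C.
Proof. by case: z => a b; rewrite normc_def. Qed.

Lemma cabs_ge0 z : 0 <= cabs z.
Proof. by case: z => a b; apply: sqrtr_ge0. Qed.

Lemma cabs_real (r : R) : cabs r%:C = `|r|.
Proof. by rewrite /= expr0n addr0 sqrtr_sqr. Qed.

Lemma cabs_gt0 z : (0 < cabs z) = (z != 0).
Proof. by rewrite -ltcR -cabsE normr_gt0. Qed.

Lemma cabsB x y : cabs (x - y) = cabs (y - x).
Proof. by rewrite -opprB normcN. Qed.

Lemma cabs_leB x y : cabs (x - y) <= cabs x + cabs y.
Proof. by rewrite (le_trans (le_normcD _ _))// normcN. Qed.

Lemma cabsX z n : cabs (z ^+ n) = cabs z ^+ n.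
Proof.
elim: n => [|n IHn]; first by rewrite !expr0 ComplexField.Normc.normc1.
by rewrite !exprS ComplexField.Normc.normcM IHn.
Qed.

Lemma cabs_sum (I : Type) (s : seq I) (P : pred I) (F : I -> R[i]) :
  cabs (\sum_(i <- s | P i) F i) <= \sum_(i <- s | P i) cabs (F i).
Proof.
elim/big_rec2: _ => [|i y1 y2 _ IH]; first by rewrite ComplexField.Normc.normc0.
by rewrite (le_trans (le_normcD _ _))// lerD2l.
Qed.

Lemma cabs_prod (I : Type) (s : seq I) (P : pred I) (F : I -> R[i]) :
  cabs (\prod_(i <- s | P i) F i) = \prod_(i <- s | P i) cabs (F i).
Proof.
elim/big_rec2: _ => [|i y1 y2 _ IH]; first by rewrite ComplexField.Normc.normc1.
by rewrite ComplexField.Normc.normcM IH.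
Qed.

(** The norm of [R[i]] takes values in [R[i]]; a positive element there has zero imaginary part, so
    real radii suffice. *)
Lemma ccvgP (T : Type) (F : set_system T) {FF : Filter F} (f : T -> R[i]^o) l :
  f @ F --> (l : R[i]^o) <->
  forall e : R, 0 < e -> \forall t \near F, cabs (l - f t) < e.
Proof.
rewrite cvgrPdist_lt; split=> H e e0.
  have := H e%:C; rewrite ltcR => /(_ e0).
  by apply: filterS => t; rewrite cabsE ltcR.
have eE : e = (complex.Re e)%:C.
  by move: e0; rewrite ltcE => /andP[/eqP]; case: (e) => x y /= ->.
have : 0 < complex.Re e by rewrite -ltcR -eE.
by move=> /H; apply: filterS => t; rewrite cabsE eE ltcR.
Qed.

Lemma ccvg_cabs (T : Type) (F : set_system T) {FF : Filter F} (f : T -> R[i]^o) l :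
  f @ F --> (l : R[i]^o) -> (fun t => cabs (f t)) @ F --> cabs l.
Proof.
move=> /ccvgP fl; apply/cvgrPdist_lt => e /fl; apply: filterS => t; apply: le_lt_trans.
rewrite ler_distl; apply/andP; split.
  rewrite lerBlDr -[X in cabs X <= _](subrK l) addrC cabsB.
  by rewrite (le_trans (le_normcD _ _))// addrC cabsB.
by rewrite -[X in cabs X <= _](subrK (f t)) addrC (le_trans (le_normcD _ _)).
Qed.

Lemma ccvg_ReIm (f : nat -> R[i]) (a b : R) :
  (@complex.Re R \o f) @ \oo --> a -> (@complex.Im R \o f) @ \oo --> b ->
  (f : nat -> R[i]^o) @ \oo --> (a +i* b : R[i]^o).
Proof.
move=> fa fb; apply/ccvgP => e e0.
have e2 : 0 < e / 2 by rewrite divr_gt0.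
near=> n.
have an : `|a - complex.Re (f n)| < e / 2.
  by near: n; apply: (cvgrPdist_lt _ _).1 fa _ e2.
have bn : `|b - complex.Im (f n)| < e / 2.
  by near: n; apply: (cvgrPdist_lt _ _).1 fb _ e2.
have -> : a +i* b - f n =
    (a - complex.Re (f n))%:C + 'i%C * (b - complex.Im (f n))%:C.
  by case: (f n) => c d; rewrite [RHS]complexE /=; simpc.
rewrite (le_lt_trans (le_normcD _ _))// ComplexField.Normc.normcM !cabs_real.
rewrite (_ : cabs 'i%C = 1) ?mul1r; first by lra.
by rewrite /= expr0n expr1n add0r sqrtr1.
Unshelve. all: by end_near. Qed.

(** Real and imaginary parts are dominated by the modulus, so the increments of each form an
    absolutely convergent real series. *)
Lemma ccvg_normed_series (u : nat -> R[i]) (g : R^nat) :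
  (forall n, cabs (u n.+1 - u n) <= g n) -> cvgn (series g) ->
  cvgn (u : nat -> R[i]^o).
Proof.
move=> ug cg.
have main (h : R[i] -> R) : (forall x y, h (x - y) = h x - h y) ->
    (forall x, `|h x| <= cabs x) -> cvgn (h \o u).
  move=> hB hn.
  have : cvgn (series (telescope (h \o u))).
    apply: normed_cvg; apply: (series_le_cvg (v_ := g)) => // n.
    - exact: normr_ge0.
    - exact: le_trans (cabs_ge0 _) (ug n).
    - by rewrite /telescope /= -hB (le_trans (hn _)).
  rewrite telescopeK => cT.
  rewrite [h \o u](_ : _ = [sequence (h \o u) n - (h \o u) 0%N]_n \+ cst ((h \o u) 0%N)).
    by apply: is_cvgD => //; exact: is_cvg_cst.
  by apply/funext => n /=; rewrite subrK.
have cR : cvgn (@complex.Re R \o u).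
  apply: main => [[a b] [c d] //|[a b] /=].
  by rewrite -(sqrtr_sqr a) ler_wsqrtr// lerDl sqr_ge0.
have cI : cvgn (@complex.Im R \o u).
  apply: main => [[a b] [c d] //|[a b] /=].
  by rewrite -(sqrtr_sqr b) ler_wsqrtr// lerDr sqr_ge0.
by apply: cvgP; apply: ccvg_ReIm; [exact: cR|exact: cI].
Qed.

End ComplexLimits.

(** * Dominated convergence for finite sums over a discrete index set *)

Section DominatedConvergence.
Context {R : realType} {T : choiceType}.
Variables (g : T -> R) (K : R) (f : nat -> T -> R[i]) (f0 : T -> R[i]).
Variable s : nat -> seq T.
Hypothesis g_sum : forall r : seq T, uniq r -> \sum_(x <- r) g x <= K.
Hypothesis fg : forall m x, cabs (f m x) <= g x.
Hypothesis s_uniq : forall m, uniq (s m).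
Hypothesis f_supp : forall m x, x \notin s m -> f m x = 0.
Hypothesis ff0 : forall x, (fun m => f m x : R[i]^o) @ \oo --> (f0 x : R[i]^o).

(** A finite sum within [e] of the supremum of all finite sums leaves less than [e] to any family
    disjoint from it. *)
Lemma dominated_small_tail (e : R) : 0 < e ->
  exists A : {fset T}, forall r : seq T, uniq r ->
    (forall x, x \in r -> x \notin A) -> \sum_(x <- r) g x < e.
Proof.
move=> e0; pose E := [set y | exists2 r : seq T, uniq r & y = \sum_(x <- r) g x].
have hE : has_sup E.
  split; first by exists 0, [::] => //; rewrite big_nil.
  by exists K => y [r ur ->]; exact: g_sum.
have [_ [r ur ->] lt] := sup_adherent e0 hE.
exists [fset x in r]%fset => t ut tA.
have : \sum_(x <- r ++ t) g x <= sup E.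
  apply: ub_le_sup; first exact: hE.2.
  exists (r ++ t) => //; rewrite cat_uniq ur ut andbT /=; apply/hasPn => x xt.
  by have := tA _ xt; rewrite in_fset.
by rewrite big_cat /=; lra.
Qed.

(** Inside [A] there are finitely many convergent terms; outside [A] the tail of [g] bounds the sum
    uniformly in [m]. *)
Lemma dominated_partial_sum (e : R) : 0 < e ->
  exists A0 : {fset T}, forall A : {fset T}, (A0 `<=` A)%fset ->
  \forall m \near \oo, cabs (\sum_(x <- s m) f m x - partial_sum f0 A) < e.
Proof.
move=> e0; have e2 : 0 < e / 2 by rewrite divr_gt0.
have [A0 tail] := dominated_small_tail e2.
exists A0 => A sA.
have cA : (fun m => \sum_(x <- A) f m x : R[i]^o) @ \oo --> (\sum_(x <- A) f0 x : R[i]^o).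
  elim: (A : seq T) => [|x r IH].
    rewrite big_nil; under eq_fun do rewrite big_nil; exact: cvg_cst.
  rewrite big_cons; under eq_fun do rewrite big_cons.
  by apply: cvgD; [exact: ff0|exact: IH].
move/ccvgP: cA => /(_ _ e2); apply: filterS => m.
rewrite /partial_sum -(big_seq_fsetE _ A predT f0) /= cabsB => lt2.
have -> : \sum_(x <- s m) f m x =
    \sum_(x <- A) f m x + \sum_(x <- s m | x \notin A) f m x.
  rewrite (bigID (mem A)) /=; congr (_ + _).
  rewrite [RHS](bigID (mem (s m))) /= [X in _ = _ + X]big1 ?addr0; last first.
    by move=> x /f_supp.
  rewrite -[LHS]big_filter -[RHS]big_filter; apply: perm_big; apply: uniq_perm.
  - by rewrite filter_uniq.
  - by rewrite filter_uniq// fset_uniq.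
  - by move=> x; rewrite !mem_filter andbC.
rewrite addrAC (le_lt_trans (le_normcD _ _))//.
suff : cabs (\sum_(x <- s m | x \notin A) f m x) < e / 2 by move=> H; lra.
rewrite (le_lt_trans (cabs_sum _ _ _))//.
apply: (@le_lt_trans _ _ (\sum_(x <- s m | x \notin A) g x)); first exact: ler_sum.
rewrite -big_filter; apply: tail; first by rewrite filter_uniq.
by move=> x; rewrite mem_filter => /andP[xA _]; apply: contra xA; apply: (fsubsetP sA).
Qed.

Lemma dominated_cvg_totally (l : R[i]) :
  (fun m => \sum_(x <- s m) f m x : R[i]^o) @ \oo --> (l : R[i]^o) ->
  (partial_sum f0 : {fset T} -> R[i]^o) @ totally --> (l : R[i]^o).
Proof.
have FT : ProperFilter (@totally T) := totally_filter.
move=> /ccvgP cl; apply/ccvgP => e e0; have e2 : 0 < e / 2 by rewrite divr_gt0.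
have [A0 HA] := dominated_partial_sum e2; exists A0 => // A sA.
(* The set [A] is fixed first; a single large [m] then meets both estimates. *)
have [m [m1 m2]] := filter_ex (filterI (HA _ sA) (cl _ e2)).
rewrite -[l](subrK (\sum_(x <- s m) f m x)) -addrA.
by rewrite (le_lt_trans (le_normcD _ _))//; lra.
Qed.

End DominatedConvergence.

Lemma dominated_cvg0 {R : realType} {T : choiceType} (g : T -> R) (K : R)
    (f : nat -> T -> R[i]) (s : nat -> seq T) :
  (forall r : seq T, uniq r -> \sum_(x <- r) g x <= K) ->
  (forall m x, cabs (f m x) <= g x) -> (forall m, uniq (s m)) ->
  (forall m x, x \notin s m -> f m x = 0) ->
  (forall x, (fun m => f m x : R[i]^o) @ \oo --> (0 : R[i]^o)) ->
  (fun m => \sum_(x <- s m) f m x : R[i]^o) @ \oo --> (0 : R[i]^o).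
Proof.
move=> gK fg us fs f0; apply/ccvgP => e e0.
have [A0 /(_ A0 (fsubset_refl _))] :=
  dominated_partial_sum (f0 := fun=> 0) gK fg us fs f0 e0.
by apply: filterS => m; rewrite /partial_sum [X in _ - X]big1// subr0 sub0r normcN.
Qed.

(** * Real powers and the finite q-binomial theorem *)

Section RealPowers.
Context {R : realType}.
Implicit Types (L x y z : R[i]) (s t : R).

Lemma cexpD x y : cexp (x + y) = cexp x * cexp y.
Proof.
case: x y => [a b] [c d]; rewrite /cexp /= expRD cosD sinD rmorphM /=.
by simpc; congr (_ +i* _); ring.
Qed.

Lemma cabs_cexp x : cabs (cexp x) = expR (complex.Re x).
Proof.
rewrite ComplexField.Normc.normcM cabs_real ger0_norm ?expR_ge0//=.
by rewrite cos2Dsin2 sqrtr1 mulr1.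
Qed.

(* A locked copy of [rpow]: the definition of [rpow] is a product, which rewriting with ring
   identities would otherwise open. *)
Definition qpow L s : R[i] := locked (@rpow R) L s.

Lemma qpowE L s : qpow L s = rpow L s.
Proof. by rewrite /qpow -lock. Qed.

Lemma qpowD L s t : qpow L (s + t) = qpow L s * qpow L t.
Proof. by rewrite !qpowE /rpow rmorphD mulrDl cexpD. Qed.

Lemma qpow0 L : qpow L 0 = 1.
Proof. by rewrite !qpowE /rpow mul0r /cexp /= expR0 cos0 sin0 mul1r. Qed.

Lemma qpow1 L : qpow L 1 = cexp L.
Proof. by rewrite !qpowE /rpow mul1r. Qed.

Lemma qpow_neq0 L s : qpow L s != 0.
Proof.
by apply/eqP => H; have := qpowD L s (- s); rewrite subrr qpow0 H mul0r => /eqP; rewrite oner_eq0.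
Qed.

Lemma qpowN L s : qpow L (- s) = (qpow L s)^-1.
Proof.
by apply: (mulfI (qpow_neq0 L s)); rewrite -qpowD subrr qpow0 divff ?qpow_neq0.
Qed.

Lemma qpowX L s n : qpow L s ^+ n = qpow L (n%:R * s).
Proof.
elim: n => [|n IHn]; first by rewrite mul0r qpow0.
by rewrite exprS IHn -qpowD; congr qpow; rewrite -[in RHS]natr1; ring.
Qed.

Lemma qpowXz L s (n : int) : qpow L s ^ n = qpow L (n%:~R * s).
Proof.
case: n => n; first exact: qpowX.
by rewrite NegzE -exprz_inv -exprnP exprVn qpowX -qpowN mulrNz mulNr.
Qed.

Lemma qpow_nat L n : qpow L 1 ^+ n = qpow L n%:R.
Proof. by rewrite qpowX mulr1. Qed.

Lemma natr_bin2 n : 'C(n, 2)%:R = n%:R * (n%:R - 1) / 2 :> R.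
Proof.
elim: n => [|n IHn]; first by rewrite mul0r mul0r.
by rewrite binS bin1 natrD IHn -natr1; field.
Qed.

Lemma qpow_bin2 L n : qpow L 1 ^+ 'C(n, 2) = qpow L (n%:R * (n%:R - 1) / 2).
Proof. by rewrite qpow_nat natr_bin2. Qed.

(** Powers of p = q^s, whose logarithm is s L, become powers of q, so exponents of both bases can be
    added. *)
Lemma qpow_scale L s t : qpow (s%:C * L) t = qpow L (s * t).
Proof. by rewrite !qpowE /rpow mulrA -rmorphM [t * s]mulrC. Qed.

Lemma cabs_qpow L s : cabs (qpow L s) = expR (s * complex.Re L).
Proof. by rewrite qpowE cabs_cexp; case: L => a b /=; rewrite mul0r subr0. Qed.

End RealPowers.

(** * The q-binomial theorem, the finite triple product and the finite double sum *)

Section QBinomial.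
Context {R : realType}.
Implicit Types (b c q z : R[i]).

Lemma qpoch0 b q : qpoch b q 0 = 1.
Proof. exact: big_ord0. Qed.

Lemma qpochS b q n : qpoch b q n.+1 = qpoch b q n * (1 - b * q ^+ n).
Proof. exact: big_ord_recr. Qed.

(* [qpochX c q N] is (cX; q)_N as a polynomial in X. *)
Definition qpochX c q N : {poly R[i]} := \prod_(k < N) (1 - (c * q ^+ k) *: 'X).

Definition qbin q N i : R[i] :=
  if (i <= N)%N then qpoch q q N / (qpoch q q i * qpoch q q (N - i)) else 0.

Lemma qpochXS c q N : qpochX c q N.+1 = qpochX c q N * (1 - (c * q ^+ N) *: 'X).
Proof. exact: big_ord_recr. Qed.

Lemma coef_qpochXS c q N i : (qpochX c q N.+1)`_i.+1 =
  (qpochX c q N)`_i.+1 - c * q ^+ N * (qpochX c q N)`_i.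
Proof. by rewrite qpochXS mulrBr mulr1 coefB -scalerAr coefZ coefMX. Qed.

Lemma coef_qpochX0 c q N : (qpochX c q N)`_0 = 1.
Proof.
elim: N => [|N IHN]; first by rewrite /qpochX big_ord0 coefC.
by rewrite qpochXS mulrBr mulr1 coefB -scalerAr coefZ coefMX IHN mulr0 subr0.
Qed.

Lemma coef_qpochX_gt c q N i : (N < i)%N -> (qpochX c q N)`_i = 0.
Proof.
elim: N i => [|N IHN] [|i] // Ni; first by rewrite /qpochX big_ord0 coefC.
by rewrite coef_qpochXS !IHN ?mulr0 ?subr0// (ltn_trans _ Ni).
Qed.

Lemma size_qpochX c q N : (size (qpochX c q N) <= N.+1)%N.
Proof. by apply/leq_sizeP => i /coef_qpochX_gt. Qed.

Lemma horner_qpochX c q N z : (qpochX c q N).[z] = qpoch (c * z) q N.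
Proof.
rewrite /qpochX horner_prod; apply: eq_bigr => k _.
by rewrite !hornerE /=; ring.
Qed.

(** The finite q-binomial theorem cleared of denominators. The coefficient recurrence closes by (1 -
    q^(j+1)) + q^(j+1) (1 - q^(i+1)) = 1 - q^(i+j+2). *)
Lemma coef_qpochX_mul c q i j :
  (qpochX c q (i + j))`_i * (qpoch q q i * qpoch q q j) =
  (- c) ^+ i * q ^+ 'C(i, 2) * qpoch q q (i + j).
Proof.
have [N] := ubnP (i + j); elim: N i j => // N IHN [|i] j.
  by rewrite coef_qpochX0 qpoch0 bin0n !expr0 !mul1r.
rewrite ltnS addSn => ij; rewrite coef_qpochXS.
have H1 := IHN i j ij.
rewrite mulrBl [X in _ - X](_ : _ = c * q ^+ (i + j) * (1 - q ^+ i.+1) *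
  ((- c) ^+ i * q ^+ 'C(i, 2) * qpoch q q (i + j))); last first.
  by rewrite -H1 qpochS -exprS; ring.
have -> : q ^+ 'C(i.+1, 2) = q ^+ 'C(i, 2) * q ^+ i by rewrite binS bin1 exprD.
(* For j = 0 the shorter product has degree at most [i], so its coefficient of index i + 1
   vanishes. *)
case: j ij H1 => [|j] ij H1.
  by rewrite addn0 coef_qpochX_gt// qpochS -exprS (exprS (- c)) ; ring.
have H2 := IHN i.+1 j; rewrite addSnnS in H2; move: H2 => /(_ ij).
have -> : q ^+ 'C(i.+1, 2) = q ^+ 'C(i, 2) * q ^+ i by rewrite binS bin1 exprD.
move=> H2; rewrite [in qpoch q q j.+1]qpochS -exprS.
rewrite [X in X - _](_ : _ = (1 - q ^+ j.+1) * ((- c) ^+ i.+1 *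
  (q ^+ 'C(i, 2) * q ^+ i) * qpoch q q (i + j.+1))); last by rewrite -H2; ring.
by rewrite qpochS -exprS (exprS (- c)) addnS !exprS exprD; ring.
Qed.

Section NotRootOfUnity.
Variable q : R[i].
Hypothesis q_neq1 : forall k, q ^+ k.+1 != 1.

Lemma qpoch_neq0 n : qpoch q q n != 0.
Proof.
by apply/prodf_neq0 => k _; rewrite -exprS subr_eq0 eq_sym.
Qed.

Lemma coef_qpochX c N i : (qpochX c q N)`_i = (- c) ^+ i * q ^+ 'C(i, 2) * qbin q N i.
Proof.
rewrite /qbin; case: leqP => [iN|/coef_qpochX_gt ->]; last by rewrite mulr0.
have nz : qpoch q q i * qpoch q q (N - i) != 0 by rewrite mulf_neq0 ?qpoch_neq0.
apply: (mulIf nz); rewrite -[RHS]mulrA divfK//.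
by have := coef_qpochX_mul c q i (N - i); rewrite subnKC.
Qed.

End NotRootOfUnity.

Lemma qbin_sub q N i : (i <= N)%N -> qbin q N (N - i) = qbin q N i.
Proof. by move=> iN; rewrite /qbin iN leq_subr subKn// [X in _ / X]mulrC. Qed.

Lemma qpoch_split c q m n :
  qpoch c q (m + n) = qpoch c q m * qpoch (c * q ^+ m) q n.
Proof.
rewrite /qpoch big_split_ord /=; congr (_ * _).
by apply: eq_bigr => k _; rewrite exprD mulrA.
Qed.

(** Factorwise 1 - q^(-k) z = -z q^(-k) (1 - q^k / z) for k = 1, ..., m; the powers of q collect to
    q^(-m(m+1)/2). *)
Lemma qpoch_inv_base (L z : R[i]) m : z != 0 ->
  qpoch (qpow L (- m%:R) * z) (qpow L 1) m * qpow L (m%:R * (m%:R + 1) / 2) =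
  (- z) ^+ m * qpoch (qpow L 1 / z) (qpow L 1) m.
Proof.
move=> z0; elim: m => [|m IHm]; first by rewrite !qpoch0 !mul0r qpow0 expr0.
have -> : qpoch (qpow L (- m.+1%:R) * z) (qpow L 1) m.+1 =
    (1 - qpow L (- m.+1%:R) * z) * qpoch (qpow L (- m%:R) * z) (qpow L 1) m.
  rewrite -add1n qpoch_split /qpoch big_ord1 expr0 mulr1; congr (_ * _).
  apply: eq_bigr => k _; congr (1 - _ * _).
  rewrite expr1 mulrAC -qpowD; congr (qpow _ _ * _).
  by rewrite -natr1; ring.
have -> : qpow L (m.+1%:R * (m.+1%:R + 1) / 2) =
    qpow L (m%:R * (m%:R + 1) / 2) * qpow L m.+1%:R.
  by rewrite -qpowD; congr qpow; rewrite -natr1; field.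
rewrite [X in _ * X]mulrC mulrACA IHm mulrC.
rewrite [X in _ * X](_ : _ = (- z) * (1 - qpow L 1 / z * qpow L 1 ^+ m)).
  by rewrite qpochS exprS; ring.
rewrite mulrBl mul1r mulrAC -qpowD addNr qpow0 mul1r mulrBr mulr1.
by rewrite -qpow_nat exprS; field.
Qed.

(** After multiplication by (-z)^m the two products join, up to a power of q, into (q^(-m) z;
    q)_(2m), which the q-binomial theorem expands; the index is then centred as k - m. *)
Lemma finite_jacobi_triple (L z : R[i]) m : z != 0 ->
  (forall k, qpow L 1 ^+ k.+1 != 1) ->
  qpoch z (qpow L 1) m * qpoch (qpow L 1 / z) (qpow L 1) m =
  \sum_(k < (m + m).+1) (- z) ^ (k%:Z - m%:Z) *
    qpow L ((k%:Z - m%:Z)%:~R * ((k%:Z - m%:Z)%:~R - 1) / 2) *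
    qbin (qpow L 1) (m + m) k.
Proof.
move=> z0 p1; have nz0 : - z != 0 by rewrite oppr_eq0.
apply: (mulfI (expf_neq0 m nz0)).
rewrite mulrCA -qpoch_inv_base// mulrA [qpoch z _ _ * _]mulrC.
have -> : qpoch (qpow L (- m%:R) * z) (qpow L 1) m * qpoch z (qpow L 1) m =
    (qpochX (qpow L (- m%:R)) (qpow L 1) (m + m)).[z].
  rewrite horner_qpochX qpoch_split; congr (_ * qpoch _ _ _).
  by rewrite qpow_nat mulrAC -qpowD addNr qpow0 mul1r.
rewrite (horner_coef_wide _ (size_qpochX _ _ _)) mulr_suml mulr_sumr.
apply: eq_bigr => k _; rewrite coef_qpochX//.
have E1 : (- z) ^+ m * (- z) ^ (k%:Z - m%:Z) = (- z) ^+ k.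
  by rewrite !exprnP -expfzDr// addrC subrK.
have E2 : (- qpow L (- m%:R)) ^+ k * z ^+ k = qpow L (- m%:R) ^+ k * (- z) ^+ k.
  by rewrite -!exprMn mulNr mulrN.
have E3 : qpow L (- m%:R) ^+ k * qpow L 1 ^+ 'C(k, 2) * qpow L (m%:R * (m%:R + 1) / 2) =
    qpow L ((k%:Z - m%:Z)%:~R * ((k%:Z - m%:Z)%:~R - 1) / 2).
  rewrite qpowX qpow_bin2 -!qpowD; congr qpow.
  by rewrite rmorphB /=; field.
rewrite -E3; move: E1 E2.
move: (qpow L (m%:R * _ / 2)) (qbin _ _ _) (qpow L 1 ^+ 'C(_, _)) => r Q B.
move: ((- qpow _ _) ^+ k) (qpow _ (- _) ^+ k) (z ^+ k) ((- z) ^+ k) ((- z) ^+ m) ((- z) ^ _).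
move=> a e b t x y E1 E2; transitivity (e * t * B * Q * r).
  by rewrite -E2; ring.
by rewrite -E1; ring.
Qed.

Lemma sum_coefM (p q : {poly R[i]}) m n (W : nat -> R[i]) :
  (size p <= m.+1)%N -> (size q <= n.+1)%N ->
  \sum_(i < m.+1) \sum_(j < n.+1) W (i + j)%N * (p`_i * q`_j) =
  \sum_(k < (m + n).+1) W k * (p * q)`_k.
Proof.
move=> sp sq.
have polyE_wide (r : {poly R[i]}) d : (size r <= d)%N -> r = \poly_(i < d) r`_i.
  move=> sr; apply/polyP => i; rewrite coef_poly; case: ltnP => // di.
  by rewrite nth_default// (leq_trans sr).
have coef_pq k : (p * q)`_k =
    \sum_(i < m.+1) \sum_(j < n.+1) (k == i + j)%N%:R * (p`_i * q`_j).
  rewrite [p in LHS](polyE_wide _ _ sp) [q in LHS](polyE_wide _ _ sq).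
  rewrite !poly_def mulr_suml coef_sum; apply: eq_bigr => i _.
  rewrite mulr_sumr coef_sum; apply: eq_bigr => j _.
  by rewrite -scalerAl -scalerAr scalerA -exprD coefZ coefXn mulrC.
under [RHS]eq_bigr => k _.
  rewrite coef_pq mulr_sumr.
  under eq_bigr => i _ do rewrite mulr_sumr.
  over.
rewrite [RHS]exchange_big; apply: eq_bigr => i _ /=.
rewrite [RHS]exchange_big; apply: eq_bigr => j _ /=.
have ij : (i + j < (m + n).+1)%N by rewrite ltnS leq_add// -ltnS.
rewrite (bigD1 (Ordinal ij)) //= eqxx mul1r big1 ?addr0// => k kij.
rewrite (_ : (_ == _)%N = false) ?mul0r ?mulr0//.
by apply: contraNF kij => /eqP kE; apply/eqP/val_inj.
Qed.

(* In (X;q)_{M+1} (q^{-M}X;q)_{M+1} the factor 1 - X occurs twice; setting one copy aside, the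
   remaining factors form the single product (q^{-M}X;q)_{2M+1}. *)
Lemma qpochX_mirror (L : R[i]) M :
  qpochX 1 (qpow L 1) M.+1 * qpochX (qpow L (- M%:R)) (qpow L 1) M.+1 =
  qpochX (qpow L (- M%:R)) (qpow L 1) (M + M.+1) * (1 - 'X).
Proof.
rewrite [qpochX (qpow L (- M%:R)) _ M.+1]qpochXS qpow_nat -qpowD addNr qpow0 scale1r.
rewrite mulrA; congr (_ * _); rewrite mulrC /qpochX big_split_ord /=; congr (_ * _).
apply: eq_bigr => k _; rewrite exprD mulrA (qpow_nat L M) -qpowD addNr qpow0.
by rewrite mul1r.
Qed.

(** The lower index is an integer because shifts such as k - 1 reach negative values, where the
    coefficient is 0. *)
Definition qbinz q N (x : int) : R[i] := if x is Posz i then qbin q N i else 0.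

Lemma sign_expz (k m : nat) : (-1 : R[i]) ^ (k%:Z - m%:Z) = (-1) ^+ k * (-1) ^+ m.
Proof. by rewrite expfzDr ?oppr_eq0 ?oner_eq0// -exprnN -exprVn invrN1. Qed.

(** The q-binomial is symmetric, and with j' = M+1-j the exponent j(j-1)/2 equals M(M+1)/2 - M j' +
    j'(j'-1)/2. Reading one factor backwards turns dependence on i - j into dependence on i + j. *)
Lemma coef_qpochX_mirror (L : R[i]) M j : (forall k, qpow L 1 ^+ k.+1 != 1) ->
  (j <= M.+1)%N ->
  (qpochX 1 (qpow L 1) M.+1)`_j =
  (-1) ^+ M.+1 * qpow L (M.+1%:R * M%:R / 2) *
    (qpochX (qpow L (- M%:R)) (qpow L 1) M.+1)`_(M.+1 - j).
Proof.
move=> q1 jM; rewrite !coef_qpochX// qbin_sub// !mulrA; congr (_ * _).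
rewrite [(- qpow _ _) ^+ _]exprNn (qpowX _ (- _)) !qpow_bin2.
have -> : (-1) ^+ M.+1 * qpow L (M.+1%:R * M%:R / 2) *
    ((-1) ^+ (M.+1 - j) * qpow L ((M.+1 - j)%:R * - M%:R)) *
    qpow L ((M.+1 - j)%:R * ((M.+1 - j)%:R - 1) / 2) =
  ((-1) ^+ M.+1 * (-1) ^+ (M.+1 - j)) * (qpow L (M.+1%:R * M%:R / 2) *
    qpow L ((M.+1 - j)%:R * - M%:R) *
    qpow L ((M.+1 - j)%:R * ((M.+1 - j)%:R - 1) / 2)).
  by rewrite -!mulrA; congr (_ * _); rewrite mulrCA.
rewrite -!qpowD; congr (_ * qpow _ _).
  rewrite -exprD -[LHS]signr_odd -[RHS]signr_odd oddD oddB//.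
  by rewrite addbA addbb.
by rewrite natrB// -natr1; field.
Qed.

(** Once [j] is reversed, the weight depends on i + j only, so the double sum reads off the
    coefficients of a product of two polynomials; its factor 1 - X yields the two q-binomials. *)
Lemma finite_double_sum (L : R[i]) M (W : int -> R[i]) :
  (forall k, qpow L 1 ^+ k.+1 != 1) ->
  \sum_(i < M.+2) \sum_(j < M.+2) W (i%:Z - j%:Z) *
    ((qpochX 1 (qpow L 1) M.+1)`_i * (qpochX 1 (qpow L 1) M.+1)`_j) =
  \sum_(k < (M.+1 + M.+1).+1) W (k%:Z - M.+1%:Z) * (-1) ^ (k%:Z - M.+1%:Z) *
    (qpow L ((k%:Z - M%:Z)%:~R * ((k%:Z - M%:Z)%:~R - 1) / 2) *
       qbinz (qpow L 1) (M + M.+1) k%:Z +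
     qpow L ((k%:Z - M.+1%:Z)%:~R * ((k%:Z - M.+1%:Z)%:~R - 1) / 2) *
       qbinz (qpow L 1) (M + M.+1) (k%:Z - 1)).
Proof.
have swap (a b x y z w : R[i]) : x * y * z = w -> a * x * (b * y) * z = b * a * w.
  by move=> <-; ring.
move=> q1; pose kappa := (-1) ^+ M.+1 * qpow L (M.+1%:R * M%:R / 2).
transitivity (kappa * \sum_(i < M.+2) \sum_(j < M.+2) W ((i + j)%:Z - M.+1%:Z) *
    ((qpochX 1 (qpow L 1) M.+1)`_i * (qpochX (qpow L (- M%:R)) (qpow L 1) M.+1)`_j)).
  rewrite mulr_sumr; apply: eq_bigr => i _.
  rewrite (reindex_inj rev_ord_inj) /= mulr_sumr; apply: eq_bigr => j _.
  have jM : (j <= M.+1)%N by rewrite -ltnS.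
  rewrite subSS [(qpochX 1 (qpow L 1) M.+1)`_(M.+1 - j)]coef_qpochX_mirror ?leq_subr//.
  rewrite subKn// -/kappa.
  have -> : (i%:Z - (M.+1 - j)%N%:Z = (i + j)%:Z - M.+1%:Z)%R by lia.
  ring.
rewrite (sum_coefM (fun k => W (k%:Z - M.+1%:Z)) (size_qpochX _ _ _) (size_qpochX _ _ _)).
rewrite mulr_sumr; apply: eq_bigr => k _.
rewrite mulrCA -mulrA; congr (_ * _).
rewrite qpochX_mirror mulrBr mulr1 coefB coefMX mulrBr mulrDr; congr (_ + _).
  rewrite /qbinz coef_qpochX// !mulrA; congr (_ * _).
  rewrite sign_expz [(- qpow _ _) ^+ _]exprNn (qpowX _ (- _)) qpow_bin2 /kappa.
  by apply: swap; rewrite -!qpowD; congr qpow; rewrite rmorphB /= -!natr1; field.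
(* At k = 0 the shift by X contributes nothing, in agreement with [qbinz] at index -1. *)
case: (nat_of_ord k) => [|{}k]; first by rewrite /qbinz /= !mulr0 oppr0.
have -> : (k.+1%:Z - 1 = k%:Z)%R by lia.
rewrite /= coef_qpochX// !mulrA -mulNr; congr (_ * _).
rewrite sign_expz [(- qpow _ _) ^+ _]exprNn (qpowX _ (- _)) qpow_bin2 /kappa.
rewrite (exprS _ k) mulN1r !mulNr; congr (- _).
by apply: swap; rewrite -!qpowD; congr qpow; rewrite rmorphB /= -!natr1; field.
Qed.

End QBinomial.

(** * Bounds and limits of q-Pochhammer symbols and theta terms *)

Section QPochhammerLimits.
Context {R : realType}.
Implicit Types (b q : R[i]).

Lemma sum_expr_le (r : R) n : 0 <= r < 1 -> \sum_(k < n) r ^+ k <= (1 - r)^-1.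
Proof.
move=> /andP[r0 r1]; have r1' : 0 < 1 - r by rewrite subr_gt0.
rewrite -[leRHS]mul1r ler_pdivlMr// mulrC -opprB mulNr -subrX1 opprB.
by rewrite gerBl exprn_ge0.
Qed.

(** Each factor is at most 1 + |b| |q|^k <= exp(|b| |q|^k), and the exponents form a geometric
    series. *)
Lemma cabs_qpoch_le b q n : cabs q < 1 ->
  cabs (qpoch b q n) <= expR (cabs b / (1 - cabs q)).
Proof.
move=> q1; rewrite /qpoch cabs_prod.
apply: (@le_trans _ _ (expR (\sum_(k < n) cabs b * cabs q ^+ k))).
  rewrite expR_sum; apply: ler_prod => k _; rewrite cabs_ge0/=.
  rewrite (le_trans (cabs_leB _ _))// ComplexField.Normc.normc1.
  by rewrite ComplexField.Normc.normcM cabsX expR_ge1Dx.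
rewrite ler_expR -mulr_sumr ler_wpM2l ?cabs_ge0// sum_expr_le//.
by rewrite cabs_ge0.
Qed.

(** Consecutive differences are -(b;q)_n b q^n, hence geometrically small; this gives the total
    [limn] in [qpoch_inf] its meaning. *)
Lemma cvg_qpoch b q : cabs q < 1 ->
  (qpoch b q : nat -> R[i]^o) @ \oo --> (qpoch_inf b q : R[i]^o).
Proof.
move=> q1; apply: (@ccvg_normed_series _ (qpoch b q)
  (geometric (expR (cabs b / (1 - cabs q)) * cabs b) (cabs q))).
  move=> n; rewrite qpochS mulrBr mulr1 addrAC subrr sub0r normcN.
  rewrite !ComplexField.Normc.normcM cabsX mulrA ler_wpM2r ?exprn_ge0 ?cabs_ge0//.
  by rewrite ler_wpM2r ?cabs_ge0// cabs_qpoch_le.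
by apply: is_cvg_geometric_series; rewrite ger0_norm ?cabs_ge0.
Qed.

(** With r = |q| and x = r^(k+1), 1/(1-x) = 1 + x/(1-x) <= exp(r^k/(1-r)). Being uniform in [n], the
    bound keeps denominators and the infinite product away from 0. *)
Lemma cabs_qpoch_ge q n : cabs q < 1 ->
  expR (- ((1 - cabs q)^-1 / (1 - cabs q))) <= cabs (qpoch q q n).
Proof.
move=> q1; rewrite /qpoch cabs_prod; set r := cabs q.
have r0 : 0 <= r by exact: cabs_ge0.
have r1 : 0 < 1 - r by rewrite subr_gt0.
apply: (@le_trans _ _ (expR (\sum_(k < n) - (r ^+ k / (1 - r))))).
  rewrite ler_expR sumrN lerN2 -mulr_suml ler_wpM2r ?invr_ge0 ?(ltW r1)//.
  by rewrite sum_expr_le// r0.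
rewrite expR_sum; apply: ler_prod => k _; rewrite expR_ge0/=.
set x := r ^+ k.+1.
have x0 : 0 <= x by rewrite exprn_ge0.
have xr : x <= r by rewrite /x exprS ler_piMr// exprn_ile1// ltW.
have xk : x <= r ^+ k by rewrite /x exprS ler_piMl ?exprn_ge0// ltW.
have x1 : 0 < 1 - x by lra.
apply: (@le_trans _ _ (1 - x)); last first.
  rewrite lerBlDr -[X in X <= _]ComplexField.Normc.normc1 -[X in cabs X <= _](subrK (q * q ^+ k)).
  by rewrite (le_trans (le_normcD _ _))// lerD2l -exprS cabsX.
rewrite expRN -[leRHS]invrK lef_pV2 ?posrE ?expR_gt0 ?invr_gt0//.
apply: (@le_trans _ _ (1 + x / (1 - x))).
  by rewrite le_eqVlt (_ : 1 + x / (1 - x) = (1 - x)^-1) ?eqxx//; field; rewrite lt0r_neq0.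
rewrite (le_trans (expR_ge1Dx _))// ler_expR ler_pM ?invr_ge0 ?(ltW x1)//.
by rewrite lef_pV2 ?posrE//; lra.
Qed.

Lemma qpoch_inf_neq0 q : cabs q < 1 -> qpoch_inf q q != 0.
Proof.
move=> q1; rewrite -cabs_gt0.
apply: (lt_le_trans (expR_gt0 (- ((1 - cabs q)^-1 / (1 - cabs q))))).
have cQ : (fun n => cabs (qpoch q q n)) @ \oo --> cabs (qpoch_inf q q).
  by apply: ccvg_cabs; exact: cvg_qpoch.
apply: (cvgr_to_ge cQ).
by apply: nearW => n; exact: cabs_qpoch_ge.
Qed.

Lemma expr_neq1 q k : cabs q < 1 -> q ^+ k.+1 != 1.
Proof.
move=> q1; apply/eqP => /(congr1 (@ComplexField.Normc.normc R)).
rewrite cabsX ComplexField.Normc.normc1 => /eqP; rewrite lt_eqF//.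
by rewrite exprn_ilt1// cabs_ge0.
Qed.

(** Uniformity in both indices serves dominated convergence; it follows from the upper and lower
    Pochhammer bounds. *)
Lemma qbin_bounded q : cabs q < 1 ->
  exists2 K, 0 <= K & forall N i, cabs (qbin q N i) <= K.
Proof.
move=> q1; pose d := expR (- ((1 - cabs q)^-1 / (1 - cabs q))).
have d0 : 0 < d by exact: expR_gt0.
have K0 : 0 <= expR (cabs q / (1 - cabs q)) / (d * d).
  by rewrite divr_ge0 ?expR_ge0// mulr_ge0// ltW.
exists (expR (cabs q / (1 - cabs q)) / (d * d)) => // N i.
rewrite /qbin; case: leqP => _; last by rewrite ComplexField.Normc.normc0.
rewrite ComplexField.Normc.normcM ComplexField.Normc.normcV ComplexField.Normc.normcM.
have P0 n : 0 < cabs (qpoch q q n) by rewrite (lt_le_trans d0)// cabs_qpoch_ge.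
rewrite ler_pM ?cabs_ge0 ?invr_ge0 ?mulr_ge0 ?cabs_ge0 ?cabs_qpoch_le//.
rewrite lef_pV2 ?posrE ?mulr_gt0//.
by rewrite ler_pM ?cabs_qpoch_ge// ltW.
Qed.

(** All three Pochhammer symbols tend to the same nonzero limit, and one inverse survives. *)
Lemma cvg_qbin_center q (i j : nat -> nat) : cabs q < 1 ->
  i @ \oo --> \oo -> j @ \oo --> \oo ->
  (fun m => qbin q (i m + j m) (i m) : R[i]^o) @ \oo --> ((qpoch_inf q q)^-1 : R[i]^o).
Proof.
move=> q1 ioo joo.
have cij : (fun m => (i m + j m)%N) @ \oo --> \oo.
  by apply/cvgnyPge => A; apply: filterS ((cvgnyPge _).1 ioo A) => m; lia.
have Q0 := qpoch_inf_neq0 q1.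
have comp (h : nat -> nat) : h @ \oo --> \oo ->
    (fun m => qpoch q q (h m) : R[i]^o) @ \oo --> (qpoch_inf q q : R[i]^o).
  by move=> hoo; apply: (cvg_comp _ _ hoo); exact: cvg_qpoch.
have -> : (fun m => qbin q (i m + j m) (i m) : R[i]^o) =
    (fun m => qpoch q q (i m + j m) / (qpoch q q (i m) * qpoch q q (j m)) : R[i]^o).
  by apply/funext => m; rewrite /qbin leq_addr addKn.
have -> : (qpoch_inf q q)^-1 = qpoch_inf q q / (qpoch_inf q q * qpoch_inf q q) by field.
apply: cvgM; first exact: comp.
apply: cvgV; first by rewrite mulf_neq0.
by apply: cvgM; exact: comp.
Qed.

Lemma cvg_qbin_fixed q i : cabs q < 1 ->
  (fun m => qbin q m i : R[i]^o) @ \oo --> ((qpoch q q i)^-1 : R[i]^o).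
Proof.
move=> q1; have Q0 := qpoch_inf_neq0 q1.
have P0 n : qpoch q q n != 0 by apply: qpoch_neq0 => k; exact: expr_neq1.
rewrite -(cvg_shiftn i).
have -> : [sequence (qbin q (n + i) i : R[i]^o)]_n =
    (fun n => qpoch q q (n + i) / (qpoch q q i * qpoch q q n) : R[i]^o).
  by apply/funext => n /=; rewrite /qbin leq_addl addnK.
have -> : (qpoch q q i)^-1 = qpoch_inf q q / (qpoch q q i * qpoch_inf q q).
  by field; rewrite P0 Q0.
apply: cvgM.
  by rewrite (cvg_shiftn i (qpoch q q : nat -> R[i]^o)); exact: cvg_qpoch.
apply: cvgV; first by rewrite mulf_neq0.
by apply: cvgM; [exact: cvg_cst|exact: cvg_qpoch].
Qed.

Lemma cvg_qbinz q (N : nat -> nat) (x : nat -> int) : cabs q < 1 ->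
  (forall A : nat, \forall m \near \oo, (A%:Z <= x m)%R) ->
  (forall A : nat, \forall m \near \oo, (A%:Z <= (N m)%:Z - x m)%R) ->
  (fun m => qbinz q (N m) (x m) : R[i]^o) @ \oo --> ((qpoch_inf q q)^-1 : R[i]^o).
Proof.
move=> q1 xoo yoo.
(* Eventually 0 <= x <= N, so the integer index is a natural number. *)
apply: cvg_trans; last first.
  apply: (@cvg_qbin_center q (fun m => `|x m|%N) (fun m => `|(N m)%:Z - x m|%N) q1).
    by apply/cvgnyPge => A; apply: filterS (xoo A) => m; lia.
  by apply/cvgnyPge => A; apply: filterS (yoo A) => m; lia.
apply: near_eq_cvg; apply: filterS2 (xoo 0%N) (yoo 0%N) => m.
case: (x m) => // k _ kN; congr qbin; rewrite /=; lia.
Qed.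

End QPochhammerLimits.

(** * Summable geometric bounds for Gaussian and theta terms *)

Section GeometricBounds.
Context {R : realType}.
Implicit Types (r : R).

(** The rescaled terms [y n] have ratio 2 w r^n, which is at most 1 from some [N] on, so none
    exceeds the sum of those up to [N]. *)
Lemma gaussian_le_geometric (w r : R) : 0 <= w -> 0 <= r < 1 ->
  exists2 C, 0 <= C & forall n, w ^+ n * r ^+ 'C(n, 2) <= C * 2^-1 ^+ n.
Proof.
move=> w0 /andP[r0 r1].
pose y n := w ^+ n * r ^+ 'C(n, 2) * 2 ^+ n.
have y0 n : 0 <= y n by rewrite !mulr_ge0 ?exprn_ge0.
have [N HN] : exists N, forall n, (N <= n)%N -> w * r ^+ n * 2 <= 1.
  have : (fun n => w * r ^+ n * 2) @ \oo --> w * 0 * 2.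
    apply: cvgM; last exact: cvg_cst.
    by apply: cvgM; [exact: cvg_cst|apply: cvg_expr; rewrite ger0_norm].
  rewrite mulr0 mul0r => /cvgr_le /(_ 1 ltr01) [N _ HN].
  by exists N => n /HN.
exists (\sum_(k < N.+1) y k); first exact: sumr_ge0.
move=> n; rewrite exprVn ler_pdivlMr ?exprn_gt0// -/(y n).
elim: n => [|n IHn]; first by rewrite big_ord_recl lerDl sumr_ge0.
have [nN|Nn] := ltnP n N.
  rewrite (bigD1 (Ordinal (nN : n.+1 < N.+1)%N)) //= lerDl sumr_ge0//.
apply: le_trans IHn.
rewrite /y binS bin1 exprD !exprS.
rewrite [leLHS](_ : _ = y n * (w * r ^+ n * 2)); last by rewrite /y; ring.
by rewrite ler_piMr// HN.
Qed.

Lemma sum_half_le n : \sum_(k < n) (2^-1 : R) ^+ k <= 2.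
Proof.
rewrite (le_trans (sum_expr_le _ _))//; first by lra.
by rewrite (_ : 1 - 2^-1 = 2^-1 :> R) ?invrK//; lra.
Qed.

(** The finite family lies in a square box, over which the sum factors into two geometric sums of at
    most 2 each. *)
Lemma sum_pair_half_le (r : seq (nat * nat)) : uniq r ->
  \sum_(x <- r) (2^-1 : R) ^+ x.1 * 2^-1 ^+ x.2 <= 4.
Proof.
move=> ur.
have [N rN] : exists N, forall x, x \in r -> (x.1 < N)%N && (x.2 < N)%N.
  elim: (r) => [|a s [N IH]]; first by exists 0%N.
  exists (maxn N (maxn a.1.+1 a.2.+1)) => x; rewrite inE.
  move=> /orP[/eqP->|/IH /andP[xN yN]]; rewrite !leq_max ?leqnn ?orbT//.
  by rewrite xN yN.
pose t := [seq (i, j) | i <- iota 0 N, j <- iota 0 N].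
have ut : uniq t.
  by rewrite allpairs_uniq ?iota_uniq// => -[i j] [i' j'] _ _ [-> ->].
apply: (@le_trans _ _ (\sum_(x <- t) (2^-1 : R) ^+ x.1 * 2^-1 ^+ x.2)).
  rewrite [leRHS](bigID (mem r)) /= -[X in X + _]big_filter.
  rewrite [X in _ <= X + _](perm_big r) /=; last first.
    apply: uniq_perm; rewrite ?filter_uniq// => x; rewrite mem_filter.
    apply: andb_idr => /rN /andP[x1 x2]; case: x x1 x2 => i j /= iN jN.
    by apply: allpairs_f; rewrite mem_iota.
  by rewrite lerDl sumr_ge0// => x _; rewrite mulr_ge0 ?exprn_ge0.
rewrite /t big_allpairs /=.
rewrite (_ : \sum_(i <- _) _ =
    (\sum_(i <- iota 0 N) 2^-1 ^+ i) * (\sum_(i <- iota 0 N) 2^-1 ^+ i)); last first.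
  by rewrite mulr_suml; apply: eq_bigr => i _; rewrite mulr_sumr.
have -> : iota 0 N = index_iota 0 N by rewrite /index_iota subn0.
rewrite big_mkord (_ : 4 = 2 * 2); last by rewrite -natrM.
by rewrite ler_pM ?sumr_ge0 ?sum_half_le// => k _; rewrite exprn_ge0.
Qed.

Lemma sum_int_half_le (r : seq int) : uniq r ->
  \sum_(n <- r) (2^-1 : R) ^+ `|n| <= 4.
Proof.
(* Nonnegative integers go to one axis and negative ones to the other, which reduces to the bound
   for pairs. *)
move=> ur; pose f (n : int) := match n with Posz k => (k, 0%N) | Negz k => (0%N, k.+1) end.
have finj : injective f by move=> [k|k] [l|l] // [->].
have := @sum_pair_half_le (map f r); rewrite map_inj_uniq// => /(_ ur).
rewrite big_map; apply: le_trans; rewrite le_eqVlt; apply/orP; left; apply/eqP.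
by apply: eq_bigr => -[k|k] _; rewrite /= ?expr0 ?mulr1 ?mul1r.
Qed.

(** For n = -m the term equals (p/z)^m p^(m(m-1)/2), so both half-lines are Gaussian. *)
Lemma theta_le_geometric (L z : R[i]) : cabs (qpow L 1) < 1 -> z != 0 ->
  exists2 C, 0 <= C & forall n : int,
    cabs (z ^ n * qpow L (n%:~R * (n%:~R - 1) / 2)) <= C * 2^-1 ^+ `|n|.
Proof.
move=> p1 z0; set p := qpow L 1 in p1 *.
have p01 : 0 <= cabs p < 1 by rewrite cabs_ge0.
have [C1 C10 H1] := gaussian_le_geometric (cabs_ge0 z) p01.
have [C2 C20 H2] := gaussian_le_geometric (cabs_ge0 (p / z)) p01.
exists (C1 + C2); first exact: addr_ge0.
case=> k.
  rewrite /= -qpow_bin2 ComplexField.Normc.normcM !cabsX (le_trans (H1 k))//.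
  by rewrite ler_wpM2r ?exprn_ge0// lerDl.
have -> : z ^ Negz k * qpow L ((Negz k)%:~R * ((Negz k)%:~R - 1) / 2) =
    (p / z) ^+ k.+1 * p ^+ 'C(k.+1, 2).
  rewrite NegzE -exprnN expr_div_n /p qpow_bin2 qpow_nat [RHS]mulrAC -qpowD [LHS]mulrC.
  congr (qpow _ _ * _).
  by rewrite mulrNz -[k.+1%:~R]/(k.+1%:R); field.
rewrite ComplexField.Normc.normcM !cabsX (le_trans (H2 k.+1))//.
by rewrite ler_wpM2r ?exprn_ge0// lerDr.
Qed.

Lemma cvg_theta0 (L z : R[i]) (alpha : nat -> int -> R[i]) (K : R) :
  cabs (qpow L 1) < 1 -> z != 0 ->
  (forall m n, cabs (alpha m n) <= K) ->
  (forall n, (fun m => alpha m n : R[i]^o) @ \oo --> (0 : R[i]^o)) ->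
  (fun M => \sum_(k < (M.+1 + M.+1).+1) z ^ (k%:Z - M.+1%:Z) *
     qpow L ((k%:Z - M.+1%:Z)%:~R * ((k%:Z - M.+1%:Z)%:~R - 1) / 2) *
     alpha M (k%:Z - M.+1%:Z) : R[i]^o) @ \oo --> (0 : R[i]^o).
Proof.
move=> p1 z0 aK a0; have [C C0 HC] := theta_le_geometric p1 z0.
pose th (n : int) := z ^ n * qpow L (n%:~R * (n%:~R - 1) / 2).
pose s M := [seq k%:Z - M.+1%:Z | k <- iota 0 (M.+1 + M.+1).+1].
(* Extension by zero turns sums of varying length into one family on [int]. *)
pose f M n := if n \in s M then th n * alpha M n else 0.
have K0 : 0 <= K by rewrite (le_trans (cabs_ge0 _) (aK 0%N 0)).
have fle M n : cabs (f M n) <= cabs (th n * alpha M n).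
  by rewrite /f; case: ifP => // _; rewrite ComplexField.Normc.normc0 cabs_ge0.
rewrite [X in X @ _ --> _](_ : _ = (fun M => \sum_(n <- s M) f M n : R[i]^o)); last first.
  apply/funext => M; rewrite [RHS]big_seq.
  under [RHS]eq_bigr => n ns do rewrite /f ns.
  rewrite -big_seq big_map.
  by have -> : iota 0 (M.+1 + M.+1).+1 = index_iota 0 (M.+1 + M.+1).+1; rewrite ?big_mkord.
apply: (@dominated_cvg0 _ _ (fun n => C * K * 2^-1 ^+ `|n|) (C * K * 4)).
- by move=> r /sum_int_half_le H; rewrite -mulr_sumr ler_wpM2l// mulr_ge0.
- move=> M n; rewrite (le_trans (fle _ _))// ComplexField.Normc.normcM [leRHS]mulrAC.
  by apply: ler_pM; rewrite ?cabs_ge0//; exact: HC.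
- by move=> M; rewrite map_inj_uniq ?iota_uniq// => i j; lia.
- by move=> M n /negbTE ns; rewrite /f ns.
move=> n; have : (fun m => th n * alpha m n : R[i]^o) @ \oo --> (th n * 0 : R[i]^o).
  by apply: cvgM; [exact: cvg_cst|exact: a0].
rewrite mulr0 => /ccvgP H; apply/ccvgP => e /H; apply: filterS => M.
by rewrite !sub0r !normcN; exact: le_lt_trans.
Qed.

End GeometricBounds.

(** * The double series *)

Section DoubleSum.
Context {R : realType}.
Variables (L u : R[i]) (a : R).
Hypotheses (q1 : cabs (qpow L 1) < 1) (a_gt0 : 0 < a) (u0 : u != 0).

(** Here [Lp] is a logarithm of p = q^(4a+1), [z 0] and [z 1] are the two theta arguments, and
    [c M i] is the finite stand-in for (-1)^i q^(i(i-1)/2) / (q;q)_i. *)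
Let q := qpow L 1.
Let Lp := (4 * a + 1)%:C * L.
Let p := qpow Lp 1.
Let z (s : R) := u * qpow L (2 * a + s).
Let W (n : int) := u ^ n * qpow L (2 * a * n%:~R ^+ 2).
Let c M i := (qpochX 1 q M.+1)`_i.

Lemma cabs_nome : cabs p < 1.
Proof.
have : complex.Re L < 0 by move: q1; rewrite cabs_qpow mul1r expR_lt1.
rewrite /p qpow_scale mulr1 cabs_qpow expR_lt1 => L0.
have a4 : 0 < 4 * a + 1 by rewrite addr_gt0 ?mulr_gt0.
by rewrite pmulr_rlt0.
Qed.

Lemma theta_arg_neq0 s : z s != 0.
Proof. by rewrite mulf_neq0 ?qpow_neq0. Qed.

(** Rests on (4a+1) n(n-1)/2 + (2a+s) n = 2a n^2 + n(n-1)/2 + s n. *)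
Lemma theta_term s (n : int) :
  (- z s) ^ n * qpow Lp (n%:~R * (n%:~R - 1) / 2) =
  W n * (-1) ^ n * qpow L (n%:~R * (n%:~R - 1) / 2 + s * n%:~R).
Proof.
rewrite -(mulN1r (z s)) /z /W !expfzMl qpowXz qpow_scale.
rewrite [RHS](_ : _ = (-1) ^ n * u ^ n * (qpow L (2 * a * n%:~R ^+ 2) *
  qpow L (n%:~R * (n%:~R - 1) / 2 + s * n%:~R))); last by ring.
rewrite -!mulrA; congr (_ * (_ * _)).
by rewrite -!qpowD; congr qpow; field.
Qed.

Lemma cvg_theta_sum s (e : int) :
  (fun M => \sum_(k < (M.+1 + M.+1).+1) (- z s) ^ (k%:Z - M.+1%:Z) *
     qpow Lp ((k%:Z - M.+1%:Z)%:~R * ((k%:Z - M.+1%:Z)%:~R - 1) / 2) *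
     qbinz q (M + M.+1) (k%:Z + e) : R[i]^o) @ \oo -->
  (qpoch_inf (z s) p * qpoch_inf (p / z s) p * qpoch_inf p p / qpoch_inf q q : R[i]^o).
Proof.
have p1 := cabs_nome; have Q0 := qpoch_inf_neq0 q1; have P0 := qpoch_inf_neq0 p1.
(* The sum is compared with the finite triple product in base p, scaled by (p;p)_(M+1) / (q;q)_oo;
   [alpha] is the difference of the coefficients, bounded and pointwise tending to 0 for every fixed
   shift [e]. *)
pose alpha M n := qbinz q (M + M.+1) (n + M.+1%:Z + e) -
  qpoch p p M.+1 * qbinz p (M.+1 + M.+1) (n + M.+1%:Z) / qpoch_inf q q.
have shift (h : nat -> R[i]) l : (h : nat -> R[i]^o) @ \oo --> (l : R[i]^o) ->
    (fun M => h M.+1 : R[i]^o) @ \oo --> (l : R[i]^o).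
  by move=> hl; rewrite (cvg_shiftS (h : nat -> R[i]^o)).
rewrite [X in X @ _ --> _](_ : _ = (fun M =>
    (\sum_(k < (M.+1 + M.+1).+1) (- z s) ^ (k%:Z - M.+1%:Z) *
     qpow Lp ((k%:Z - M.+1%:Z)%:~R * ((k%:Z - M.+1%:Z)%:~R - 1) / 2) *
     alpha M (k%:Z - M.+1%:Z)) + qpoch (z s) p M.+1 * qpoch (p / z s) p M.+1 *
     qpoch p p M.+1 / qpoch_inf q q : R[i]^o)); last first.
  apply/funext => M.
  rewrite finite_jacobi_triple ?theta_arg_neq0//; last by move=> k; exact: expr_neq1.
  rewrite -[X in _ = _ + X]mulrA mulr_suml -big_split /=; apply: eq_bigr => k _.
  by rewrite /alpha subrK [qbinz p _ _]/=; ring.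
rewrite -[X in _ --> X]add0r; apply: cvgD.
  have [Kq Kq0 HKq] := qbin_bounded q1; have [Kp Kp0 HKp] := qbin_bounded p1.
  pose B := expR (cabs p / (1 - cabs p)).
  have qbinz_le r K N x : 0 <= K -> (forall N i, cabs (qbin r N i) <= K) ->
      cabs (qbinz r N x) <= K.
    by move=> K0 HK; case: x => k; [exact: HK|rewrite ComplexField.Normc.normc0].
  apply: (@cvg_theta0 _ _ _ alpha (Kq + B * Kp / cabs (qpoch_inf q q))).
  - exact: p1.
  - by rewrite oppr_eq0 theta_arg_neq0.
  - move=> M n; rewrite (le_trans (cabs_leB _ _))// lerD ?qbinz_le//.
    rewrite !ComplexField.Normc.normcM ComplexField.Normc.normcV.
    rewrite ler_wpM2r ?invr_ge0 ?cabs_ge0//.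
    by rewrite ler_pM ?cabs_ge0 ?qbinz_le// cabs_qpoch_le.
  move=> n.
  have -> : 0 = (qpoch_inf q q)^-1 - qpoch_inf p p * (qpoch_inf p p)^-1 / qpoch_inf q q.
    by rewrite divff// mul1r subrr.
  apply: cvgB.
    apply: cvg_qbinz => // A.
      by exists (A + `|n| + `|e|)%N => // m /= Am; lia.
    by exists (A + `|n| + `|e|)%N => // m /= Am; lia.
  apply: cvgM; last exact: cvg_cst.
  apply: cvgM; first by apply: shift; exact: cvg_qpoch.
  apply: cvg_qbinz => // A.
    by exists (A + `|n|)%N => // m /= Am; lia.
  by exists (A + `|n|)%N => // m /= Am; lia.
apply: cvgM; last exact: cvg_cst.
by apply: cvgM; [apply: cvgM|]; apply: shift; exact: cvg_qpoch.
Qed.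

Lemma cvg_finite_double_sum :
  (fun M => \sum_(i < M.+2) \sum_(j < M.+2) W (i%:Z - j%:Z) * (c M i * c M j) : R[i]^o)
    @ \oo -->
  (qpoch_inf (z 1) p * qpoch_inf (p / z 1) p * qpoch_inf p p / qpoch_inf q q +
   qpoch_inf (z 0) p * qpoch_inf (p / z 0) p * qpoch_inf p p / qpoch_inf q q : R[i]^o).
Proof.
pose S s e M := \sum_(k < (M.+1 + M.+1).+1) (- z s) ^ (k%:Z - M.+1%:Z) *
  qpow Lp ((k%:Z - M.+1%:Z)%:~R * ((k%:Z - M.+1%:Z)%:~R - 1) / 2) *
  qbinz q (M + M.+1) (k%:Z + e).
(* With n = k - M - 1, the q-binomial at [k] carries q^(n(n+1)/2) and goes with [z 1]; the one at k
   - 1 carries q^(n(n-1)/2) and goes with [z 0]. *)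
rewrite [X in X @ _ --> _](_ : _ = (fun M => S 1 0 M + S 0 (-1) M : R[i]^o)).
  by apply: cvgD; exact: cvg_theta_sum.
apply/funext => M; rewrite /c finite_double_sum; last by move=> k; exact: expr_neq1.
rewrite /S -big_split /=; apply: eq_bigr => k _.
rewrite !theta_term mul0r !addr0 mul1r mulrDr !mulrA.
congr (_ * qpow _ _ * _ + _); last by rewrite addn0.
have -> : (k%:Z - M%:Z)%:~R = (k%:Z - M.+1%:Z)%:~R + 1 :> R.
  by rewrite !rmorphB /= -[M.+1%:~R]/(M.+1%:R) -natr1; ring.
by field.
Qed.

(** [W n] is itself a theta term, with argument [z 0] and base q^(4a), whose modulus is below 1
    because a > 0. *)
Lemma cabs_theta_weight_le :
  exists2 C, 0 <= C & forall n, cabs (W n) <= C.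
Proof.
have p4 : cabs (qpow ((4 * a)%:C * L) 1) < 1.
  have : complex.Re L < 0 by move: q1; rewrite cabs_qpow mul1r expR_lt1.
  by rewrite qpow_scale mulr1 cabs_qpow expR_lt1 => L0; rewrite pmulr_rlt0// mulr_gt0.
have [C C0 HC] := theta_le_geometric p4 (theta_arg_neq0 0).
exists C => // n; rewrite (_ : W n = z 0 ^ n * qpow ((4 * a)%:C * L) (n%:~R * (n%:~R - 1) / 2)).
  by rewrite (le_trans (HC n))// ler_piMr// exprn_ile1//; lra.
rewrite /W /z expfzMl qpowXz qpow_scale -[RHS]mulrA -qpowD; congr (_ * qpow _ _).
by field.
Qed.

(** Since [W] is bounded and |c M i| is at most a constant times 2^(-i) uniformly in [M], the finite
    double sums are dominated by a multiple of 2^(-i-j); their limit passes to the series. *)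
Lemma double_series_cvg :
  (partial_sum (fun ij : nat * nat => let: (i, j) := ij in
      W (i%:Z - j%:Z) * ((-1) ^+ i * q ^+ 'C(i, 2) / qpoch q q i *
                         ((-1) ^+ j * q ^+ 'C(j, 2) / qpoch q q j))) :
     {fset nat * nat} -> R[i]^o) @ totally -->
  (qpoch_inf (z 1) p * qpoch_inf (p / z 1) p * qpoch_inf p p / qpoch_inf q q +
   qpoch_inf (z 0) p * qpoch_inf (p / z 0) p * qpoch_inf p p / qpoch_inf q q : R[i]^o).
Proof.
have [C C0 HC] := cabs_theta_weight_le.
have [K K0 HK] := qbin_bounded q1.
have q01 : 0 <= cabs q < 1 by rewrite cabs_ge0.
have [G G0 HG] := gaussian_le_geometric (ler01 : 0 <= 1 :> R) q01.
have cE M i : c M i = (-1) ^+ i * q ^+ 'C(i, 2) * qbin q M.+1 i.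
  by rewrite /c coef_qpochX// => k; exact: expr_neq1.
have c_le M i : cabs (c M i) <= G * K * 2^-1 ^+ i.
  rewrite cE !ComplexField.Normc.normcM !cabsX normcN ComplexField.Normc.normc1.
  rewrite [leRHS]mulrAC ler_pM ?mulr_ge0 ?exprn_ge0 ?cabs_ge0//.
have GK0 : 0 <= G * K by rewrite mulr_ge0.
pose f M (ij : nat * nat) := W (ij.1%:Z - ij.2%:Z) * (c M ij.1 * c M ij.2).
pose s M := [seq (i, j) | i <- iota 0 M.+2, j <- iota 0 M.+2].
apply: (@dominated_cvg_totally _ _ (fun ij => C * (G * K) ^+ 2 * (2^-1 ^+ ij.1 * 2^-1 ^+ ij.2))
  (C * (G * K) ^+ 2 * 4) f _ s).
- move=> r ur; rewrite -mulr_sumr ler_wpM2l ?sum_pair_half_le//.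
  by rewrite mulr_ge0// exprn_ge0.
- move=> M [i j].
  rewrite /f /= (ComplexField.Normc.normcM (W _)) (ComplexField.Normc.normcM (c _ _)).
  rewrite -[leRHS]mulrA ler_pM ?mulr_ge0 ?cabs_ge0//.
  by rewrite expr2 [leRHS]mulrACA ler_pM ?cabs_ge0//.
- by move=> M; rewrite allpairs_uniq ?iota_uniq// => -[i j] [i' j'] _ _ [-> ->].
- move=> M [i j] ijs; suff : (M.+1 < i)%N || (M.+1 < j)%N.
    by rewrite /f /= /c => /orP[] /coef_qpochX_gt ->; rewrite ?mul0r ?mulr0 ?mulr0.
  apply: contraNT ijs; rewrite negb_or -!leqNgt => /andP[iM jM].
  by apply: allpairs_f; rewrite mem_iota.
- move=> [i j]; rewrite /f /=.
  apply: cvgM; first exact: cvg_cst.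
  have cc k : (fun M => c M k : R[i]^o) @ \oo -->
      ((-1) ^+ k * q ^+ 'C(k, 2) / qpoch q q k : R[i]^o).
    under eq_fun do rewrite cE.
    apply: cvgM; first exact: cvg_cst.
    rewrite (cvg_shiftS (fun m => qbin q m k : R[i]^o)).
    exact: cvg_qbin_fixed.
  by apply: cvgM; exact: cc.
rewrite [X in X @ _ --> _](_ : _ = (fun M =>
  \sum_(i < M.+2) \sum_(j < M.+2) W (i%:Z - j%:Z) * (c M i * c M j) : R[i]^o)).
  exact: cvg_finite_double_sum.
apply/funext => M; rewrite /s -[iota 0 M.+2]/(index_iota 0 M.+2) big_allpairs /f.
by rewrite big_mkord; apply: eq_bigr => i _; rewrite big_mkord.
Qed.

End DoubleSum.

(* Convergence along [totally] (finite subsets of nat * nat ordered by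
   inclusion) is unconditional convergence of the double series. *)
Theorem theorem3p7 (R : realType) (q logq u : R[i]) (a : R)
    (hq : 0 < `|q| < 1) (hlogq : cexp logq = q) (ha : 0 < a) (hu : u != 0) :
  let p := rpow logq (4 * a + 1) in
  partial_sum
    (fun ij : nat * nat => let: (i, j) := ij in
       (-1) ^+ (i + j) * u ^ (i%:Z - j%:Z)
       * rpow logq ((i%:R ^+ 2 - i%:R + j%:R ^+ 2 - j%:R
                     + 4 * a * (i%:R - j%:R) ^+ 2) / 2)
       / (qpoch q q i * qpoch q q j) : R[i]^o) @ totally
  --> ((qpochs_inf [:: u^-1 * rpow logq (2 * a);
                       u * rpow logq (2 * a + 1);
                       rpow logq (4 * a + 1)] p
        + qpochs_inf [:: u * rpow logq (2 * a);
                         u^-1 * rpow logq (2 * a + 1);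
                         rpow logq (4 * a + 1)] p)
       / qpoch_inf q q : R[i]^o).
Proof.
have qE : q = qpow logq 1 by rewrite qpow1.
have q1 : cabs (qpow logq 1) < 1 by case/andP: hq => _; rewrite -qE cabsE ltcR.
have pE : rpow logq (4 * a + 1) = qpow ((4 * a + 1)%:C * logq) 1.
  by rewrite qpow_scale mulr1 qpowE.
(* As 4a + 1 = (2a + s) + (2a + t), the arguments p / z are those with u inverted and s, t
   exchanged. *)
have conj s t : s + t = 1 -> qpow ((4 * a + 1)%:C * logq) 1 / (u * qpow logq (2 * a + s)) =
    u^-1 * qpow logq (2 * a + t).
  move=> st; rewrite qpow_scale invfM mulrCA -qpowN -qpowD; congr (_ * qpow _ _).
  have -> : t = 1 - s by rewrite -st addrAC subrr add0r.
  by ring.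
have conj1 := conj _ _ (addr0 1); have conj0 := conj _ _ (add0r 1).
set P := qpow _ 1 in pE conj1 conj0.
move=> p.
have limE : (qpochs_inf [:: u^-1 * rpow logq (2 * a); u * rpow logq (2 * a + 1);
      rpow logq (4 * a + 1)] p + qpochs_inf [:: u * rpow logq (2 * a);
      u^-1 * rpow logq (2 * a + 1); rpow logq (4 * a + 1)] p) / qpoch_inf q q =
    qpoch_inf (u * qpow logq (2 * a + 1)) P *
      qpoch_inf (P / (u * qpow logq (2 * a + 1))) P * qpoch_inf P P / qpoch_inf q q +
    qpoch_inf (u * qpow logq (2 * a + 0)) P *
      qpoch_inf (P / (u * qpow logq (2 * a + 0))) P * qpoch_inf P P / qpoch_inf q q.
  rewrite -mulrDl; congr (_ / _).
  rewrite conj1 conj0 addr0 /p pE -!qpowE /qpochs_inf !big_cons !big_nil !mulr1.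
  congr (_ + _); last by rewrite mulrA.
  by rewrite mulrA [X in X * _ = _]mulrC.
rewrite limE qE.
(* The summand splits into a weight in i - j and separate factors in [i] and [j]. *)
rewrite [X in partial_sum X](_ : _ = (fun ij : nat * nat => let: (i, j) := ij in
      u ^ (i%:Z - j%:Z) * qpow logq (2 * a * (i%:Z - j%:Z)%:~R ^+ 2) *
      ((-1) ^+ i * qpow logq 1 ^+ 'C(i, 2) / qpoch (qpow logq 1) (qpow logq 1) i *
      ((-1) ^+ j * qpow logq 1 ^+ 'C(j, 2) / qpoch (qpow logq 1) (qpow logq 1) j)))).
  exact: (double_series_cvg q1 ha hu).
apply/funext => -[i j]; rewrite -qpowE.
have -> : (i%:R ^+ 2 - i%:R + j%:R ^+ 2 - j%:R + 4 * a * (i%:R - j%:R) ^+ 2) / 2 =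
    2 * a * (i%:Z - j%:Z)%:~R ^+ 2 + i%:R * (i%:R - 1) / 2 + j%:R * (j%:R - 1) / 2 :> R.
  by rewrite rmorphB /=; field.
rewrite !qpowD -!qpow_bin2 exprD invfM; move: (qpoch _ _ i)^-1 (qpoch _ _ j)^-1 => x y.
move: ((-1) ^+ i) ((-1) ^+ j) (u ^ _) (qpow _ (2 * a * _)) => b c d e.
by move: (qpow _ _ ^+ 'C(i, 2)) (qpow _ _ ^+ 'C(j, 2)) => f g; ring.
Qed.
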